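(* Assume $L$ satisfies Hypothesis $(\mathrm C_\kappa)$ for some step bound $\kappa\in\mathbb N$, and let $s_0$ be an admissible initial state whose orbit $(s_t)_{t\ge0}$ satisfies Hypothesis (B). Then the orbit is eventually periodic: there exist $t_0$, $P\ge1$ and a unit $\lambda\in\mathcal O_K^\times$ with $\sigma_r(\lambda)>0$ such that $s_{t+P}=\lambda\,s_t$ for all $t\ge t_0$, and the digit sequence is eventually $P$-periodic.
   Context: $K$ is a cubic number field of signature $(1,1)$, with real embedding $\sigma_r$, complex embedding $\sigma_c$ and field norm $N$; $L\subset\mathcal O_K$ is an order. A state is an ordered triple $s=(u_1,u_2,u_3)$ of elements of $L$ forming a $\mathbb Q$-basis of $K$; it is admissible if $x_i=\sigma_r(u_i)>0$ for all $i$, and sorted so that $x_1\ge x_2\ge x_3>0$. For a unit $\lambda$, $\lambda s=(\lambda u_1,\lambda u_2,\lambda u_3)$. The height is $H(s)=\max_i|N(u_i)|$. Conformal module: put $\xi=(x_1,x_2,x_3)$, $\hat\xi=\xi/|\xi|$, $(\sigma_c(u_1),\sigma_c(u_2),\sigma_c(u_3))=a+ib$ with $a,b\in\mathbb R^3$, $a_\perp=a-\langle a,\hat\xi\rangle\hat\xi$, $b_\perp=b-\langle b,\hat\xi\rangle\hat\xi$; then $m(s)=(|a_\perp|^2+|b_\perp|^2)/(2|a_\perp\times b_\perp|)$. Algorithm: for $A,B,g\in\mathbb Z_{\ge0}$ not all zero, the move $V(A,B,g)$ sends $(u_1,u_2,u_3)$ to $(u_1-g(u_2-Bu_3)-Au_3,\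 u_2-Bu_3,\ u_3)$, and $W$ sends it to $(u_1-u_2,\ u_2,\ u_3-(u_1-u_2))$. At a state $s$ the candidates are the images under those moves for which all new real coordinates are positive. The algorithm selects the candidate of minimal $m$, ties being broken by a fixed total order depending only on the move labels, and re-sorts it to get the next state. The orbit of $s_0$ is the resulting sequence $(s_t)$; its digit sequence is the sequence of selected moves. Hypothesis $(\mathrm C_\kappa)$ for $L$: there exist $\gamma>1$ and $m_0\ge1$ such that from every admissible state $s$ of $L$ with $m(s)\ge m_0$, the orbit of the algorithm started at $s$ reaches a state of module $\le\max(m(s)/\gamma,\,m_0)$ within at most $\kappa$ steps. Hypothesis (B) for an orbit $(s_t)$: $\liminf_{t\to\infty}H(s_t)<\infty$. *)

(* Defs.v *)
From HB Require Import structures.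
From mathcomp Require Import all_boot all_order all_algebra all_field.
From mathcomp Require Import all_classical all_reals all_analysis.
From mathcomp Require Export complex.

Set Implicit Arguments.
Unset Strict Implicit.
Unset Printing Implicit Defensive.

Import Order.TTheory GRing.Theory Num.Theory.
Local Open Scope ring_scope.
Local Open Scope complex_scope.

Definition has_signature11 (R : realType) (K : fieldExtType rat)
    (sigma_r : {rmorphism K -> R}) (sigma_c : {rmorphism K -> R[i]}) : Prop :=
  [/\ forall tau : {rmorphism K -> R}, tau =1 sigma_r,
      exists x, complex.Im (sigma_c x) != 0
    & forall tau : {rmorphism K -> R[i]},
        (exists x, complex.Im (tau x) != 0) ->
        tau =1 sigma_c \/ tau =1 (fun x => (sigma_c x)^*%C) ].

Definition field_norm (K : fieldExtType rat) (x : K) : rat :=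
  let e := vbasis {:K} in
  \det (\matrix_(i < \dim {:K}, j < \dim {:K}) coord e j (x * tnth e i)).

Definition in_OK (K : fieldExtType rat) (x : K) : Prop :=
  integralOver (intr : int -> K) x.

Definition is_unit_OK (K : fieldExtType rat) (x : K) : Prop :=
  [/\ x != 0, in_OK x & in_OK x^-1].

Definition is_order (K : fieldExtType rat) (L : {pred K}) : Prop :=
  [/\ GRing.subring_closed L,
      forall x, x \in L -> in_OK x
    & exists2 e : (\dim {:K}).-tuple K, basis_of {:K} e
        & forall x, x \in L <->
            exists c : 'I_(\dim {:K}) -> int, x = \sum_i (c i)%:~R * tnth e i].

(* The library norm on row vectors is the sup norm, hence the Euclidean one. *)
Definition dot (R : realType) (u v : 'rV[R]_3) : R := \sum_i u 0 i * v 0 i.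

Definition enorm (R : realType) (u : 'rV[R]_3) : R := Num.sqrt (dot u u).

(* Indices are in the additive group 'I_3, that is, modulo 3. *)
Definition cross (R : realType) (u v : 'rV[R]_3) : 'rV[R]_3 :=
  \row_(k < 3) (u 0 (k + 1) * v 0 (k + 2%:R) - u 0 (k + 2%:R) * v 0 (k + 1)).

Definition perp (R : realType) (xi a : 'rV[R]_3) : 'rV[R]_3 :=
  let xih := (enorm xi)^-1 *: xi in a - dot a xih *: xih.

(* moveV 0 0 0 is excluded by the constructor's side condition. *)
Inductive move : Type :=
| moveV (A B g : nat) of (0 < A + B + g)%N
| moveW.

HB.instance Definition _ := gen_eqMixin move.
HB.instance Definition _ := gen_choiceMixin move.

Definition is_total_order (le : rel move) : Prop :=
  [/\ reflexive le, antisymmetric le, transitive le & total le].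

Definition apply_move (K : fieldExtType rat) (d : move) (s : 3.-tuple K) :
    3.-tuple K :=
  let u1 := tnth s 0 in let u2 := tnth s 1 in let u3 := tnth s 2%:R in
  match d with
  | moveV A B g _ =>
      [tuple u1 - (u2 - u3 *+ B) *+ g - u3 *+ A; u2 - u3 *+ B; u3]
  | moveW => [tuple u1 - u2; u2; u3 - (u1 - u2)]
  end.

Definition scale_state (K : fieldExtType rat) (lambda : K) (s : 3.-tuple K) :
    3.-tuple K :=
  map_tuple (fun u => lambda * u) s.

Definition is_state (K : fieldExtType rat) (L : {pred K}) (s : 3.-tuple K) :
    Prop :=
  (forall i, tnth s i \in L) /\ basis_of {:K} s.

Definition state_height (K : fieldExtType rat) (s : 3.-tuple K) : rat :=
  \big[Num.max/0]_(i < 3) `|field_norm (tnth s i)|.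

Section Algorithm.

Context (R : realType) (K : fieldExtType rat).
Context (sigma_r : {rmorphism K -> R}) (sigma_c : {rmorphism K -> R[i]}).
Context (tie : rel move).
Implicit Types (s : 3.-tuple K) (d : move).

Definition positive_state s : Prop := forall i, 0 < sigma_r (tnth s i).

Definition sorted_state s : Prop :=
  sorted (fun u v => sigma_r v <= sigma_r u) s.

Definition admissible s : Prop := positive_state s /\ sorted_state s.

Definition conf_module s : R :=
  let xi := \row_(i < 3) sigma_r (tnth s i) in
  let ap := perp xi (\row_(i < 3) complex.Re (sigma_c (tnth s i))) in
  let bp := perp xi (\row_(i < 3) complex.Im (sigma_c (tnth s i))) in
  (enorm ap ^+ 2 + enorm bp ^+ 2) / (2 * enorm (cross ap bp)).

Definition resort_state s : 3.-tuple K :=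
  sort_tuple (fun u v => sigma_r v <= sigma_r u) s.

Definition candidate s d : Prop := positive_state (apply_move d s).

Definition selected s d : Prop :=
  candidate s d /\
  forall d', candidate s d' ->
    conf_module (apply_move d s) < conf_module (apply_move d' s) \/
    conf_module (apply_move d s) = conf_module (apply_move d' s) /\ tie d d'.

(* At an admissible basis s exactly one move is selected when [tie] is a total
   order: x1 > x3 makes moveV 1 0 0 a candidate, and positivity leaves finitely
   many candidates.  So the default value moveW of xget is never used there. *)
Definition algo_select s : move := xget moveW [set d | selected s d]%classic.

Definition algo_step s : 3.-tuple K := resort_state (apply_move (algo_select s) s).

Definition algo_orbit s (t : nat) : 3.-tuple K := iter t algo_step s.

Definition algo_digit s (t : nat) : move := algo_select (algo_orbit s t).

Definition hypC (L : {pred K}) (kappa : nat) : Prop :=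
  exists gamma m0 : R, [/\ 1 < gamma, 1 <= m0
    & forall s, is_state L s -> admissible s -> m0 <= conf_module s ->
        exists2 t, (t <= kappa)%N &
          conf_module (algo_orbit s t) <= Num.max (conf_module s / gamma) m0].

Definition hypB s : Prop :=
  (limn_einf (fun t => (ratr (state_height (algo_orbit s t)) : R)%:E) < +oo)%E.

End Algorithm.

(* Main.v *)
Require Import Defs.
From HB Require Import structures.
From mathcomp Require Import all_boot all_order all_algebra all_fingroup all_field.
From mathcomp Require Import all_classical all_reals all_analysis.
From mathcomp Require Import ring lra zify.

(** The matrix of a state has the rows (sigma_r u_i, Re sigma_c u_i,
    Im sigma_c u_i).  Its determinant is nonzero exactly on bases, and every
    move is unimodular, so the absolute value D of the determinant is constant
    along an orbit.  Writing xi, a, b for the columns, a_perp x b_perp is a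
    multiple of xi by a factor det / |xi|^2, whence
      m(s) = (|a_perp|^2 + |b_perp|^2) |xi| / (2 D)      [conf_moduleE].

    The module is bounded along the whole orbit.  Subtracting u_3 from u_1 is
    always a candidate, and |a_perp| is a distance to the line spanned by xi,
    so this subtraction multiplies m by at most 3; the selected move does at
    least as well [conf_module_step].  Thus m grows by at most a fixed factor
    in the bounded number of steps in which the contraction hypothesis brings
    it back [conf_module_orbit_bounded].

    By the hypothesis on heights, N(u_1) <= M for some M at infinitely many
    times.  Infinitely many of these share the residue class of u_1 modulo M!
    in the order L.  Since N(v) is a multiple of v in L, two elements of L of
    norm at most M that are congruent modulo M! have quotients in L in both
    directions, so they differ by a unit [quotient_in_order].  Multiply the
    states at those times by units so that all have the same first entry.
    For such states the bounds on m and D bound |a_perp| and |b_perp|, and the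
    sorting makes the coordinate along xi controlled by the fixed first entry,
    so all embeddings of all entries are bounded [place_bound].  Only finitely
    many triples of lattice elements satisfy this, and two of the states
    agree: s_(t2) = lambda s_(t1) [recurrence_up_to_unit].

    The algorithm commutes with multiplication by lambda when sigma_r lambda > 0,
    because m is invariant and real coordinates keep their signs and order; one
    recurrence therefore forces periodicity [periodic_from_recurrence]. *)

Set Implicit Arguments.
Unset Strict Implicit.
Unset Printing Implicit Defensive.

Import Order.TTheory GRing.Theory Num.Theory.
Local Open Scope ring_scope.
Local Open Scope complex_scope.

(** * Three-dimensional linear algebra *)

Lemma ord3P (i : 'I_3) : [\/ i = 0, i = 1 | i = 2%:R].
Proof.
by case: i => [[|[|[|//]]] Hi]; [apply: Or31 | apply: Or32 | apply: Or33];
  apply/val_inj.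
Qed.

Lemma sum_ord3 (V : nmodType) (F : 'I_3 -> V) :
  \sum_i F i = F 0 + F 1 + F 2%:R.
Proof.
rewrite !big_ord_recl big_ord0 addr0 addrA.
by congr (F _ + F _ + F _); apply/val_inj.
Qed.

Lemma det_ord3 (A : comNzRingType) (M : 'M[A]_3) :
  \det M = M 0 0 * (M 1 1 * M 2%:R 2%:R - M 1 2%:R * M 2%:R 1)
         - M 0 1 * (M 1 0 * M 2%:R 2%:R - M 1 2%:R * M 2%:R 0)
         + M 0 2%:R * (M 1 0 * M 2%:R 1 - M 1 1 * M 2%:R 0).
Proof.
rewrite (expand_det_row _ 0) sum_ord3 /cofactor.
rewrite !(expand_det_row _ ord0) !big_ord_recl !big_ord0 /cofactor !det_mx11 !mxE.
have E01 : lift (0 : 'I_3) (0 : 'I_2) = 1 by apply/val_inj.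
have E02 : lift (0 : 'I_3) (lift (0 : 'I_2) 0) = 2%:R by apply/val_inj.
have E10 : lift (1 : 'I_3) (0 : 'I_2) = 0 by apply/val_inj.
have E12 : lift (1 : 'I_3) (lift (0 : 'I_2) 0) = 2%:R by apply/val_inj.
have E20 : lift (2%:R : 'I_3) (0 : 'I_2) = 0 by apply/val_inj.
have E21 : lift (2%:R : 'I_3) (lift (0 : 'I_2) 0) = 1 by apply/val_inj.
have F1 : lift (lift (0 : 'I_2) 0) 0 = 0 :> 'I_2 by apply/val_inj.
rewrite ?(E01, E02, E10, E12, E20, E21, F1) /= /bump /=.
have -> : ((1 %% 3 + 1 %% 3) %% 3 = 2)%N by [].
have -> : (1 %% 3 = 1)%N by [].
ring.
Qed.

Lemma ord3_add : (1 + 2%:R = 0 :> 'I_3) * (1 + 1 = 2%:R :> 'I_3)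
  * (2%:R + 1 = 0 :> 'I_3) * (2%:R + 2%:R = 1 :> 'I_3).
Proof. by do !split; apply/val_inj. Qed.

Section Dot.
Context (R : realType).
Implicit Types u v xi a : 'rV[R]_3.

Lemma dotE u v : dot u v = u 0 0 * v 0 0 + u 0 1 * v 0 1 + u 0 2%:R * v 0 2%:R.
Proof. exact: sum_ord3. Qed.

Lemma dot_ge0 u : 0 <= dot u u.
Proof. by apply: sumr_ge0 => i _; rewrite -expr2 sqr_ge0. Qed.

Lemma sqr_enorm u : enorm u ^+ 2 = dot u u.
Proof. by rewrite sqr_sqrtr // dot_ge0. Qed.

Lemma enorm_ge0 u : 0 <= enorm u. Proof. exact: sqrtr_ge0. Qed.

Lemma enormZ c u : enorm (c *: u) = `|c| * enorm u.
Proof.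
rewrite /enorm -sqrtr_sqr -sqrtrM ?sqr_ge0 //.
by congr Num.sqrt; rewrite !dotE !mxE; ring.
Qed.

(** For xi nonzero, the minimum over t of |a - t xi|^2; see [sqdist_line_le]. *)
Definition sqdist_line xi a : R := dot a a - dot a xi ^+ 2 / dot xi xi.

Lemma perpE xi a : perp xi a = a - (dot a xi / dot xi xi) *: xi.
Proof.
rewrite /perp scalerA; congr (a - _ *: xi).
have -> : dot a ((enorm xi)^-1 *: xi) = (enorm xi)^-1 * dot a xi.
  by rewrite !dotE !mxE; ring.
by rewrite -sqr_enorm expr2 invfM; ring.
Qed.

Lemma dot_sub_line xi a t : dot xi xi != 0 ->
  dot (a - t *: xi) (a - t *: xi) =
  sqdist_line xi a + (t - dot a xi / dot xi xi) ^+ 2 * dot xi xi.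
Proof.
rewrite /sqdist_line => h0.
transitivity (dot a a - 2 * t * dot a xi + t ^+ 2 * dot xi xi).
  by rewrite !dotE !mxE; ring.
by field.
Qed.

Lemma sqdist_line_perp xi a : dot xi xi != 0 ->
  sqdist_line xi a = dot (perp xi a) (perp xi a).
Proof. by move=> h; rewrite perpE dot_sub_line // subrr expr0n mul0r addr0. Qed.

Lemma sqdist_line_le xi a t : dot xi xi != 0 ->
  sqdist_line xi a <= dot (a - t *: xi) (a - t *: xi).
Proof. by move=> h; rewrite dot_sub_line // lerDl mulr_ge0 ?sqr_ge0 ?dot_ge0. Qed.

Lemma sqdist_line_ge0 xi a : dot xi xi != 0 -> 0 <= sqdist_line xi a.
Proof. by move=> h; rewrite sqdist_line_perp // dot_ge0. Qed.

Definition triple (xi a b : 'rV[R]_3) : R := dot xi (cross a b).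

Lemma tripleE xi a b : triple xi a b =
    xi 0 0 * (a 0 1 * b 0 2%:R - a 0 2%:R * b 0 1)
  + xi 0 1 * (a 0 2%:R * b 0 0 - a 0 0 * b 0 2%:R)
  + xi 0 2%:R * (a 0 0 * b 0 1 - a 0 1 * b 0 0).
Proof. by rewrite /triple dotE !mxE !add0r !ord3_add. Qed.

(** Removing multiples of xi from a and b does not change their triple product
    with xi, and both projections are orthogonal to xi, so their cross product
    is parallel to xi. *)
Lemma cross_perp xi a b : dot xi xi != 0 ->
  cross (perp xi a) (perp xi b) = (triple xi a b / dot xi xi) *: xi.
Proof.
move=> h; rewrite !perpE tripleE; apply/rowP => i; rewrite !mxE.
move: h; rewrite !dotE => h.
by case: (ord3P i) => ->; rewrite ?add0r ?ord3_add; field.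
Qed.

(** The hypothesis on xi makes the multiple of xi in a largest at index 0, where
    it can be read off from a 0 0.  The bound C + 1 replaces the square root
    of C. *)
Lemma entry_bound xi a (C : R) :
  (forall i, 0 < xi 0 i <= xi 0 0) -> sqdist_line xi a <= C ->
  forall i, `|a 0 i| <= `|a 0 0| + 2 * (C + 1).
Proof.
move=> hxi hC i.
have h0 : 0 < dot xi xi.
  by rewrite dotE; have /andP[h _] := hxi 0; have /andP[h1 _] := hxi 1;
    have /andP[h2 _] := hxi 2%:R; rewrite !addr_gt0 // mulr_gt0.
move: hC; rewrite sqdist_line_perp ?lt0r_neq0 // perpE.
set t := _ / _; set y := a - _ => hC.
have C0 : 0 <= C := le_trans (dot_ge0 y) hC.
have hy k : `|y 0 k| <= C + 1.
  have : y 0 k ^+ 2 <= C.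
    apply: le_trans hC; rewrite /dot (bigD1 k) //= expr2 lerDl.
    by apply: sumr_ge0 => j _; rewrite -expr2 sqr_ge0.
  rewrite -real_normK ?num_real //; have := normr_ge0 (y 0 k); nra.
have ay k : a 0 k = y 0 k + t * xi 0 k by rewrite !mxE; ring.
have ht : `|t * xi 0 i| <= `|t * xi 0 0|.
  have /andP[p0 _] := hxi 0; have /andP[pi pile] := hxi i.
  by rewrite !normrM ler_wpM2l // !gtr0_norm.
have -> : a 0 i = y 0 i + t * xi 0 i by [].
have E : t * xi 0 0 = a 0 0 - y 0 0 by rewrite ay; ring.
have := ler_normB (a 0 0) (y 0 0); rewrite -E.
have := ler_normD (y 0 i) (t * xi 0 i).
have := hy 0; have := hy i; lra.
Qed.

End Dot.

(** * Minima, recurrence in sequences, and powers *)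

Lemma exists_least (T : eqType) (r : rel T) (l : seq T) (P : T -> Prop) :
  total r -> transitive r -> (exists2 x, x \in l & P x) ->
  exists2 x, P x & forall y, y \in l -> P y -> r x y.
Proof.
move=> rtot rtr [z zl Pz].
have := sort_sorted rtot [seq x <- l | `[< P x >]].
have hm := mem_sort r [seq x <- l | `[< P x >]].
case E: (sort _ _) hm => [|x l'] hm /=.
  by have := hm z; rewrite mem_filter zl asboolT.
move/(order_path_min rtr)/allP => hx.
have := hm x; rewrite mem_head mem_filter => /esym/andP[/asboolP Px _].
exists x => // y yl Py; have := hm y; rewrite mem_filter yl asboolT // inE.
by case/orP => [/eqP->|/hx//]; have := rtot x x; rewrite orbb.
Qed.

Lemma infinitely_often_le (R : realType) (u : nat -> R) :
  (limn_einf (fun t => (u t)%:E) < +oo)%E ->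
  exists M : R, forall N, exists2 t, (N <= t)%N & u t <= M.
Proof.
move=> h; apply: contrapT => /forallNP hn; move: h.
suff -> : limn_einf (fun t => (u t)%:E) = +oo%E by rewrite ltxx.
apply: (fun H => (cvg_limn_einf_sup H).1).
apply/cvgeyPge => A; have /existsNP[N hN] := hn A.
exists N => // t /= Nt; rewrite lee_fin leNgt; apply/negP => /ltW ut.
by apply: hN; exists t.
Qed.

Lemma pigeonhole_infinite (T : finType) (f : nat -> T) (P : nat -> Prop) :
  (forall N, exists2 t, (N <= t)%N & P t) ->
  exists c, forall N, exists2 t, (N <= t)%N & P t /\ f t = c.
Proof.
move=> hP; apply: contrapT => /forallNP hn.
have /choice[b hb] : forall c, exists N, forall t, (N <= t)%N -> P t -> f t <> c.
  move=> c; have /existsNP[N hN] := hn c.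
  by exists N => t Nt Pt ft; apply: hN; exists t.
have [t ht Pt] := hP (\max_c b c).
by apply: (hb (f t) t) => //; exact: leq_trans (leq_bigmax _) ht.
Qed.

Lemma expr_unbounded (R : realType) (g x : R) : 1 < g -> exists n, x <= g ^+ n.
Proof.
move=> g1; have g0 : 0 < g - 1 by rewrite subr_gt0.
have hn n : n%:R * (g - 1) <= g ^+ n.
  elim: n => [|n IH]; first by rewrite mul0r.
  have : 1 <= g ^+ n by rewrite exprn_ege1 // ltW.
  rewrite exprS -natr1; nra.
exists (Num.bound (`|x| / (g - 1))); apply: le_trans (hn _).
rewrite -ler_pdivrMr //; apply: ltW; apply: le_lt_trans (archi_boundP _); last first.
  by rewrite divr_ge0 // ltW.
by rewrite ler_pM2r ?invr_gt0 // ler_norm.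
Qed.

(** * Embeddings, determinants and norms *)

Section Orbits.
Context (R : realType) (K : fieldExtType rat).
Context (sigma_r : {rmorphism K -> R}) (sigma_c : {rmorphism K -> R[i]}).
Implicit Types (s e : 3.-tuple K) (d : move) (u v : K).
Local Notation conf_module := (conf_module sigma_r sigma_c).
Local Notation positive_state := (positive_state sigma_r).
Local Notation admissible := (admissible sigma_r).
Local Notation resort_state := (resort_state sigma_r).
Local Notation candidate := (candidate sigma_r).

(** Real coordinates of the embedding of K into R x C; splitting sigma_c into
    real and imaginary parts keeps all matrices real. *)
Definition place (j : 'I_3) (u : K) : R :=
  [:: sigma_r u; complex.Re (sigma_c u); complex.Im (sigma_c u)]`_j.

Lemma place_is_zmod_morphism j : zmod_morphism (place j).
Proof.
move=> u v; case: (ord3P j) => ->; rewrite /place /= !rmorphB //.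
all: by case: (sigma_c u) => ? ?; case: (sigma_c v) => ? ?.
Qed.

HB.instance Definition _ j := GRing.isZmodMorphism.Build K R (place j)
  (place_is_zmod_morphism j).

Lemma placeZ j q u : place j (q *: u) = ratr q * place j u.
Proof.
have Er : sigma_r (q *: u) = ratr q * sigma_r u.
  by rewrite -mulr_algl rmorphM -(fmorph_eq_rat (sigma_r \o in_alg K)).
have Ec : sigma_c (q *: u) = (ratr q : R)%:C * sigma_c u.
  rewrite -mulr_algl rmorphM -[(ratr q)%:C]/((real_complex R \o ratr) q).
  rewrite (fmorph_eq_rat (real_complex R \o ratr)).
  by rewrite -(fmorph_eq_rat (sigma_c \o in_alg K)).
case: (ord3P j) => ->; rewrite /place /= ?Er ?Ec //.
all: case: (sigma_c u) => ? ? /=; ring.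
Qed.

Definition embmx (s : 3.-tuple K) : 'M[R]_3 :=
  \matrix_(i, j) place j (tnth s i).

Definition coordmx (e s : 3.-tuple K) : 'M[rat]_3 :=
  \matrix_(i, j) coord e j (tnth s i).

Lemma embmx_coord e s : basis_of {:K} e ->
  embmx s = map_mx ratr (coordmx e s) *m embmx e.
Proof.
move=> he; apply/matrixP => i j; rewrite !mxE.
rewrite {1}(coord_basis he (memvf (tnth s i))).
rewrite raddf_sum /=; apply: eq_bigr => k _.
by rewrite placeZ !mxE !(tnth_nth 0).
Qed.

(** Multiplication by u in the coordinates [place], acting on rows. *)
Definition place_mulmx (u : K) : 'M[R]_3 :=
  let x := place 0 u in let p := place 1 u in let q := place 2%:R u in
  \matrix_(i, j) (nth [::] [:: [:: x; 0; 0]; [:: 0; p; q]; [:: 0; - q; p]] i)`_j.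

(** The field norm sigma_r u * |sigma_c u|^2 as a real number, see
    [real_norm_field_norm]. *)
Definition real_norm (u : K) : R := place 0 u * (place 1 u ^+ 2 + place 2%:R u ^+ 2).

Lemma det_place_mulmx u : \det (place_mulmx u) = real_norm u.
Proof. rewrite det_ord3 !mxE /= /real_norm; ring. Qed.

Lemma embmx_scale u s : embmx (scale_state u s) = embmx s *m place_mulmx u.
Proof.
apply/matrixP => i j; rewrite !mxE sum_ord3 !mxE tnth_map.
case: (ord3P j) => ->; rewrite /place /= rmorphM //=; first by ring.
all: case: (sigma_c u) => ? ?; case: (sigma_c _) => ? ? /=; ring.
Qed.

Lemma det_embmx_scale u s :
  \det (embmx (scale_state u s)) = \det (embmx s) * real_norm u.
Proof. by rewrite embmx_scale det_mulmx det_place_mulmx. Qed.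

Lemma real_normM u v : real_norm (u * v) = real_norm u * real_norm v.
Proof.
rewrite /real_norm /place /= !rmorphM.
case: (sigma_c u) => ? ?; case: (sigma_c v) => ? ? /=; ring.
Qed.

Lemma real_norm_gt0 u : 0 < sigma_r u -> 0 < real_norm u.
Proof.
move=> h; rewrite /real_norm mulr_gt0 //.
have : sigma_c u != 0.
  by rewrite fmorph_eq0; apply: contraL h => /eqP ->; rewrite rmorph0 ltxx.
rewrite /place /= eq_complex /=; case: (sigma_c u) => p q /=.
rewrite lt0r addr_ge0 ?sqr_ge0 // andbT; apply: contra.
by rewrite paddr_eq0 ?sqr_ge0 // !sqrf_eq0.
Qed.

Context (dimK : \dim {:K} = 3%N).
Context (has_complex : exists x, complex.Im (sigma_c x) != 0).

(** It suffices to find one triple with nonzero determinant, since its matrix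
    factors through that of s.  For x with sigma_c x not real the triple
    1, x, x^2 gives, up to a constant factor, the Vandermonde determinant with
    the three distinct nodes sigma_r x, sigma_c x and its conjugate. *)
Lemma det_embmx_neq0 s : basis_of {:K} s -> \det (embmx s) != 0.
Proof.
have [x hx] := has_complex; move=> hs; apply/eqP => ds0.
have := embmx_coord [tuple 1; x; x * x] hs.
move/(congr1 (fun M => \det M)); rewrite det_mulmx ds0 mulr0.
move/eqP; rewrite det_ord3 !mxE /place /= !rmorph1 !rmorphM /=.
case: (sigma_c x) hx => p q /= q0.
set r := sigma_r x.
have -> : forall z, z == 0 = (z * q == 0).
  by move=> z; rewrite mulIr_eq0 //; apply/mulIf.
move: q0; rewrite -sqrf_eq0 => q0.
(* The Vandermonde determinant is q |sigma_c x - r|^2; multiplying it by q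
   makes it a product of visibly nonnegative factors. *)
set E := (X in X == 0).
have -> : E = q ^+ 2 * (q ^+ 2 + (p - r) ^+ 2) by rewrite /E; ring.
rewrite mulf_eq0 (negbTE q0) /= => /eqP E0.
have := sqr_ge0 (p - r); have : 0 < q ^+ 2 by rewrite lt0r q0 sqr_ge0.
lra.
Qed.

(** The converse: a rational linear relation between the entries of s is a
    relation between the rows of its matrix. *)
Lemma basis_embmx s : \det (embmx s) != 0 -> basis_of {:K} s.
Proof.
move=> ds; rewrite basisEfree subvf dimK size_tuple leqnn !andbT.
apply/freeP => k hk.
have e0 : (\row_i ratr (k i) : 'rV[R]_3) *m embmx s = 0.
  apply/rowP => j; rewrite !mxE.
  transitivity (place j (\sum_(i < 3) k i *: s`_i)); last by rewrite hk raddf0.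
  rewrite raddf_sum /=; apply: eq_bigr => i _.
  by rewrite placeZ !mxE !(tnth_nth 0).
have us : embmx s \in unitmx by rewrite unitmxE unitfE.
move=> i; have := congr1 (fun M => (M *m invmx (embmx s)) 0 i) e0.
rewrite mulmxK // mul0mx !mxE => /eqP; rewrite fmorph_eq0; exact/eqP.
Qed.

(** Comparing the two ways to compute det (embmx (u e)): through the coordinates
    of K over the rationals and through the embeddings. *)
Lemma real_norm_coord e u : basis_of {:K} e ->
  real_norm u = ratr (\det (coordmx e (scale_state u e))).
Proof.
move=> he; have := det_embmx_scale u e.
rewrite (embmx_coord (scale_state u e) he) det_mulmx det_map_mx => E.
by apply: (mulfI (det_embmx_neq0 he)); rewrite -E mulrC.
Qed.

Lemma real_norm_field_norm u : real_norm u = ratr (field_norm u).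
Proof.
rewrite /field_norm.
have := vbasisP {:K}; move: (vbasis {:K}); rewrite dimK => e he.
rewrite (real_norm_coord u he); congr (ratr (\det _)).
by apply/matrixP => i j; rewrite !mxE tnth_map.
Qed.

(** * The conformal module *)

Definition placev s (j : 'I_3) : 'rV[R]_3 := \row_i place j (tnth s i).

Lemma triple_placev s :
  triple (placev s 0) (placev s 1) (placev s 2%:R) = \det (embmx s).
Proof. by rewrite tripleE det_ord3 !mxE; ring. Qed.

Lemma positive_dot s : positive_state s -> 0 < dot (placev s 0) (placev s 0).
Proof.
move=> hs; rewrite dotE !mxE /place /= -!expr2.
have := exprn_gt0 2 (hs 0); have := exprn_gt0 2 (hs 1).
have := exprn_gt0 2 (hs 2%:R); by move=> *; rewrite !addr_gt0.
Qed.

(** By [cross_perp], |a_perp x b_perp| = |det| / |xi|.  The denominator of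
    this form is constant along orbits. *)
Lemma conf_moduleE s : positive_state s ->
  conf_module s = (sqdist_line (placev s 0) (placev s 1)
      + sqdist_line (placev s 0) (placev s 2%:R)) * enorm (placev s 0)
    / (2 * `|\det (embmx s)|).
Proof.
move=> /positive_dot hs; have h0 := lt0r_neq0 hs.
have n0 : enorm (placev s 0) != 0 by rewrite /enorm sqrtr_eq0 -ltNge.
rewrite /Defs.conf_module.
rewrite -[\row_i sigma_r _]/(placev s 0) -[\row_i complex.Re _]/(placev s 1).
rewrite -[\row_i complex.Im _]/(placev s 2%:R).
rewrite cross_perp // enormZ !sqr_enorm -!sqdist_line_perp // triple_placev.
rewrite normrM normfV.
rewrite [`|dot _ _|]ger0_norm ?dot_ge0 // -sqr_enorm.
rewrite !invfM invrK; move: (`|\det _|^-1) => D; by field.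
Qed.

Lemma conf_module_ge0 s : 0 <= conf_module s.
Proof. by rewrite divr_ge0 ?addr_ge0 ?mulr_ge0 ?sqr_ge0 ?enorm_ge0. Qed.

Lemma positive_scale lam s : 0 < sigma_r lam ->
  positive_state (scale_state lam s) <-> positive_state s.
Proof.
move=> h; split => hs i; have := hs i; rewrite tnth_map rmorphM /=.
  by rewrite pmulr_rgt0.
exact: mulr_gt0.
Qed.

(** Multiplication by a unit multiplies xi by a real number k and a + i b by
    p + i q; the distances of a and b to the line of xi are only scaled when
    taken together. *)
Lemma sqdist_line_scale (k p q : R) (xi a b : 'rV[R]_3) : k != 0 -> dot xi xi != 0 ->
  sqdist_line (k *: xi) (p *: a - q *: b) + sqdist_line (k *: xi) (q *: a + p *: b)
  = (p ^+ 2 + q ^+ 2) * (sqdist_line xi a + sqdist_line xi b).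
Proof.
move=> hk h; rewrite /sqdist_line !dotE !mxE; move: h; rewrite dotE => h.
field; rewrite h /=.
have -> : forall x y z, k * x * (k * x) + k * y * (k * y) + k * z * (k * z)
  = k ^+ 2 * (x * x + y * y + z * z) by move=> *; ring.
by rewrite mulf_neq0 ?expf_neq0.
Qed.

Lemma conf_module_scale lam s : 0 < sigma_r lam -> positive_state s ->
  conf_module (scale_state lam s) = conf_module s.
Proof.
move=> hl hs; have hs' := (positive_scale s hl).2 hs.
have h0 := lt0r_neq0 (positive_dot hs).
rewrite !conf_moduleE // det_embmx_scale.
have -> : placev (scale_state lam s) 0 = place 0 lam *: placev s 0.
  by apply/rowP => i; rewrite !mxE tnth_map /place /= rmorphM.
have -> : placev (scale_state lam s) 1 =
    place 1 lam *: placev s 1 - place 2%:R lam *: placev s 2%:R.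
  apply/rowP => i; rewrite !mxE tnth_map /place /= rmorphM /=.
  by case: (sigma_c lam) => ? ?; case: (sigma_c _) => ? ? /=.
have -> : placev (scale_state lam s) 2%:R =
    place 2%:R lam *: placev s 1 + place 1 lam *: placev s 2%:R.
  apply/rowP => i; rewrite !mxE tnth_map /place /= rmorphM /=.
  case: (sigma_c lam) => ? ?; case: (sigma_c _) => ? ? /=; ring.
have := real_norm_gt0 hl; rewrite /real_norm.
have k0 : 0 < place 0 lam by [].
rewrite pmulr_rgt0 // => m0.
rewrite sqdist_line_scale ?(lt0r_neq0 k0) // enormZ gtr0_norm //.
rewrite normrM [X in _ / (2 * (_ * X))]gtr0_norm ?mulr_gt0 // !invfM.
move: (`|\det _|^-1) => D; field.
by rewrite !gt_eqF.
Qed.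

(** Sorting permutes the entries, which is invisible to [dot] and to the
    absolute value of the determinant, hence to the module. *)
Lemma resort_perm s : exists p : 'S_3, forall i,
  tnth (resort_state s) i = tnth s (p i).
Proof.
have /tuple_permP[p hp] : perm_eq (resort_state s) s by rewrite perm_sort.
exists p => i; rewrite (tnth_nth 0) hp.
by rewrite -[LHS](tnth_nth 0 [tuple tnth s (p i) | i < 3]) tnth_mktuple.
Qed.

Lemma positive_resort s : positive_state s -> positive_state (resort_state s).
Proof. by move=> hs i; have [p ->] := resort_perm s. Qed.

Lemma norm_det_resort s : `|\det (embmx (resort_state s))| = `|\det (embmx s)|.
Proof.
have [p hp] := resort_perm s.
have -> : embmx (resort_state s) = row_perm p (embmx s).
  by apply/matrixP => i j; rewrite !mxE hp.
by rewrite row_permE det_mulmx det_perm normrMsign.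
Qed.

Lemma dot_resort s j k : dot (placev (resort_state s) j) (placev (resort_state s) k)
  = dot (placev s j) (placev s k).
Proof.
have [p hp] := resort_perm s; rewrite /dot [RHS](reindex_perm p) /=.
by apply: eq_bigr => i _; rewrite !mxE hp.
Qed.

Lemma conf_module_resort s : positive_state s ->
  conf_module (resort_state s) = conf_module s.
Proof.
move=> hs; rewrite !conf_moduleE //; last exact: positive_resort.
by rewrite norm_det_resort /sqdist_line /enorm !dot_resort.
Qed.

Lemma sorted_resort s : sorted_state sigma_r (resort_state s).
Proof. by apply: sort_sorted => x y; exact: le_total. Qed.

Lemma resort_scale lam s : 0 < sigma_r lam ->
  resort_state (scale_state lam s) = scale_state lam (resort_state s).
Proof.
move=> hl; apply: val_inj; rewrite /=; apply/esym/map_sort => u v.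
by rewrite !rmorphM ler_pM2l.
Qed.

Lemma apply_move_scale lam d s :
  apply_move d (scale_state lam s) = scale_state lam (apply_move d s).
Proof.
apply: val_inj; case: d => [A B g h|] /=; rewrite !tnth_map.
  by congr [:: _; _; _]; ring.
by rewrite !mulrBr.
Qed.

(** All moves are unimodular. *)
Lemma det_apply_move d s : \det (embmx (apply_move d s)) = \det (embmx s).
Proof.
case: d => [A B g h|]; rewrite !det_ord3 !mxE !(tnth_nth 0) /= !(tnth_nth 0) /=.
  rewrite !(raddfD, raddfN, raddfMn) /= !(raddfD, raddfN, raddfMn) /=; ring.
rewrite !(raddfD, raddfN) /=; ring.
Qed.

Lemma sorted_le_first s : sorted_state sigma_r s -> forall i,
  sigma_r (tnth s i) <= sigma_r (tnth s 0).
Proof.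
case: s => -[|a [|b [|c [|]]]] // hs; rewrite /sorted_state /= andbT => /andP[h1 h2].
move=> i; case: (ord3P i) => ->; rewrite !(tnth_nth 0) //=.
exact: le_trans h2 h1.
Qed.

(** The move that every admissible basis allows. *)
Definition subtract_least : move := @moveV 1 0 0 isT.

Lemma apply_subtract_least s : apply_move subtract_least s =
  [tuple tnth s 0 - tnth s 2%:R; tnth s 1; tnth s 2%:R].
Proof. by apply: val_inj; rewrite /= mulr0n mulr1n !subr0. Qed.

(** The inequality is strict because u_1 and u_3 are independent and sigma_r is
    injective. *)
Lemma sorted_lt_first s : basis_of {:K} s -> sorted_state sigma_r s ->
  sigma_r (tnth s 2%:R) < sigma_r (tnth s 0).
Proof.
move=> hb hs; rewrite lt_neqAle (sorted_le_first hs) andbT.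
rewrite (inj_eq (fmorph_inj sigma_r)).
have := free_uniq (basis_free hb).
case: s {hb hs} => -[|a [|b [|c [|]]]] // hs; rewrite !(tnth_nth 0) /= !inE negb_or.
by case/andP => /andP[_ ac] _; rewrite eq_sym.
Qed.

Lemma candidate_subtract_least s : basis_of {:K} s -> admissible s ->
  candidate s subtract_least.
Proof.
move=> hb [hp hs] i; rewrite apply_subtract_least.
case: (ord3P i) => ->; rewrite (tnth_nth 0) /= ?rmorphB ?subr_gt0 //.
exact: sorted_lt_first.
Qed.

(** With t the coefficient of the projection of a to xi, and y = a - t xi, the
    new vector a' satisfies |a'_perp|^2 <= |a' - t xi'|^2, and a' - t xi' is the
    image (y_0 - y_2, y_1, y_2) of y, whose squared length is at most 3 |y|^2.
    Positivity gives |xi'| <= |xi|, and the determinant does not change. *)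
Lemma conf_module_subtract_least s : basis_of {:K} s -> admissible s ->
  conf_module (apply_move subtract_least s) <= 3 * conf_module s.
Proof.
move=> hb ha; have hc := candidate_subtract_least hb ha.
have [hp _] := ha; rewrite !conf_moduleE // det_apply_move.
rewrite mulrA ler_wpM2r ?invr_ge0 ?mulr_ge0 // mulrA.
have pe j i : placev (apply_move subtract_least s) j 0 i =
    placev s j 0 i - (i == 0)%:R * placev s j 0 2%:R.
  rewrite !mxE apply_subtract_least.
  case: (ord3P i) => -> /=; rewrite (tnth_nth 0) /= ?raddfB /=; ring.
have g3 j : sqdist_line (placev (apply_move subtract_least s) 0)
    (placev (apply_move subtract_least s) j) <=
      3 * sqdist_line (placev s 0) (placev s j).
  set t := dot (placev s j) (placev s 0) / dot (placev s 0) (placev s 0).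
  apply: (le_trans (sqdist_line_le _ t (lt0r_neq0 (positive_dot hc)))).
  rewrite sqdist_line_perp ?lt0r_neq0 ?positive_dot // perpE -/t !dotE.
  have E i : (placev (apply_move subtract_least s) j
      - t *: placev (apply_move subtract_least s) 0) 0 i =
    (placev s j - t *: placev s 0) 0 i
      - (i == 0)%:R * (placev s j - t *: placev s 0) 0 2%:R.
    have D (v w : 'rV[R]_3) k : (v - t *: w) 0 k = v 0 k - t * w 0 k.
      by rewrite !mxE.
    rewrite !D !pe; ring.
  rewrite !E /=; set y := placev s j - _.
  have := sqr_ge0 (y 0 0 + y 0 2%:R); have := sqr_ge0 (y 0 0 - y 0 2%:R).
  have := sqr_ge0 (y 0 1); have := sqr_ge0 (y 0 0); have := sqr_ge0 (y 0 2%:R).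
  nra.
have g0 j : 0 <= sqdist_line (placev (apply_move subtract_least s) 0)
    (placev (apply_move subtract_least s) j).
  by rewrite sqdist_line_ge0 ?lt0r_neq0 ?positive_dot.
apply: ler_pM; [exact: addr_ge0 | exact: enorm_ge0 | |].
  by rewrite mulrDr lerD.
rewrite ler_wsqrtr // !dotE !pe /= !mxE.
have := hp 0; have := hp 2%:R; rewrite -/(place 0 _) -/(place 0 (tnth s 0)).
have := sorted_lt_first hb (proj2 ha).
rewrite -/(place 0 _) -/(place 0 (tnth s 0)) => *; nra.
Qed.

Lemma scale_stateA (a b : K) s :
  scale_state a (scale_state b s) = scale_state (a * b) s.
Proof. by apply: eq_from_tnth => i; rewrite !tnth_map mulrA. Qed.

Lemma sorted_scale lam s : 0 < sigma_r lam -> sorted_state sigma_r s ->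
  sorted_state sigma_r (scale_state lam s).
Proof.
move=> hl; rewrite /sorted_state /= sorted_map; apply: sub_sorted => x y /=.
by rewrite !rmorphM ler_pM2l.
Qed.

(** * Selection of moves and equivariance *)

Context (tie : rel move) (tieP : is_total_order tie).
Local Notation selected := (selected sigma_r sigma_c tie).
Local Notation algo_select := (algo_select sigma_r sigma_c tie).
Local Notation algo_step := (algo_step sigma_r sigma_c tie).
Local Notation algo_orbit := (algo_orbit sigma_r sigma_c tie).
Local Notation algo_digit := (algo_digit sigma_r sigma_c tie).

(** A total version of [moveV], so that moves can be listed by their three
    parameters; the junk value is [moveW]. *)
Definition move_of (A B g : nat) : move :=
  if boolP (0 < A + B + g)%N is AltTrue h then moveV h else moveW.

Lemma move_ofE A B g (h : (0 < A + B + g)%N) : move_of A B g = moveV h.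
Proof.
rewrite /move_of; case: {-}_ / boolP => [h'|/negP//].
by rewrite (bool_irrelevance h' h).
Qed.

Lemma lt_archi_bound (n : nat) (x y : R) : 0 < y -> y *+ n < x ->
  (n < Num.bound (x / y))%N.
Proof.
move=> y0 h; have x0 : 0 < x by rewrite (le_lt_trans _ h) // mulrn_wge0 // ltW.
rewrite -(ltr_nat R) (le_lt_trans _ (archi_boundP (ltW (divr_gt0 x0 y0)))) //.
by rewrite ler_pdivlMr // mulr_natl ltW.
Qed.

(** Positivity of u_2 - B u_3 bounds B; for each such B the positivity of the
    first entry bounds g, by a bound that depends on B, and A. *)
Lemma finite_candidates s : positive_state s ->
  exists l : seq move, forall d, candidate s d -> d \in l.
Proof.
move=> hs.
set x1 := sigma_r (tnth s 0); set x2 := sigma_r (tnth s 1).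
set x3 := sigma_r (tnth s 2%:R).
have x30 : 0 < x3 := hs 2%:R.
pose Bs := iota 0 (Num.bound (x2 / x3)).
pose As := iota 0 (Num.bound (x1 / x3)).
pose gs (B : nat) := iota 0 (Num.bound (x1 / (x2 - x3 *+ B))).
exists (moveW :: flatten
  [seq flatten [seq [seq move_of A B g | A <- As] | g <- gs B] | B <- Bs]).
case=> [A B g h|] hc; last by rewrite inE eqxx.
have y0 : 0 < x2 - x3 *+ B.
  by have := hc 1; rewrite [tnth _ _]/(tnth s 1 - tnth s 2%:R *+ B) rmorphB rmorphMn.
have hA : 0 < x1 - (x2 - x3 *+ B) *+ g - x3 *+ A.
  have := hc 0.
  rewrite [tnth _ _]/(tnth s 0 - (tnth s 1 - tnth s 2%:R *+ B) *+ g - tnth s 2%:R *+ A).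
  by rewrite !(rmorphB, rmorphMn).
have gy : 0 <= (x2 - x3 *+ B) *+ g by rewrite mulrn_wge0 // ltW.
have Ay : 0 <= x3 *+ A by rewrite mulrn_wge0 // ltW.
rewrite in_cons -move_ofE; apply/orP; right.
apply/flatten_mapP; exists B.
  by rewrite mem_iota leq0n add0n lt_archi_bound // -subr_gt0.
apply/flatten_mapP; exists g.
  by rewrite mem_iota leq0n add0n lt_archi_bound //; move: hA; clear -Ay; lra.
apply: (map_f (fun A => move_of A B g)).
by rewrite mem_iota leq0n add0n lt_archi_bound //; move: hA; clear -gy; lra.
Qed.

(** Lexicographic order by module, then by [tie], is total and transitive, so
    it has a least element among the finitely many candidates. *)
Lemma selected_exists s : basis_of {:K} s -> admissible s ->
  exists d, selected s d.
Proof.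
move=> hb ha; have [l hl] := finite_candidates (proj1 ha).
have [tr ta tt tot] := tieP.
pose m d := conf_module (apply_move d s).
pose r d d' := (m d < m d') || ((m d == m d') && tie d d').
have [|||d hd hm] := @exists_least _ r l (candidate s) _ _ _.
- by move=> d d'; rewrite /r; case: (ltgtP (m d) (m d')) => //= _; exact: tot.
- move=> d2 d1 d3; rewrite /r.
  case/orP=> [h1|/andP[/eqP-> h1]]; last first.
    by case/orP=> [->//|/andP[-> h2]]; rewrite (tt _ _ _ h1 h2) orbT.
  by case/orP=> [h2|/andP[/eqP<- _]]; rewrite ?h1 // (lt_trans h1 h2).
- exists subtract_least; last exact: candidate_subtract_least.
  exact/hl/candidate_subtract_least.
exists d; split=> // d' hd'; have /orP[h|/andP[/eqP h1 h2]] := hm d' (hl _ hd') hd'.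
  by left.
by right.
Qed.

Lemma algo_selectP s : basis_of {:K} s -> admissible s ->
  selected s (algo_select s).
Proof.
by move=> hb ha; rewrite /Defs.algo_select; apply: xgetPex; exact: selected_exists.
Qed.

Lemma admissible_step s : basis_of {:K} s -> admissible s ->
  admissible (algo_step s).
Proof.
move=> hb ha; have [hc _] := algo_selectP hb ha.
by split; [exact: positive_resort | exact: sorted_resort].
Qed.

(** The selected move does not have a larger module than [subtract_least]. *)
Lemma conf_module_step s : basis_of {:K} s -> admissible s ->
  conf_module (algo_step s) <= 3 * conf_module s.
Proof.
move=> hb ha; have [hc hm] := algo_selectP hb ha.
rewrite /Defs.algo_step conf_module_resort //.
apply: le_trans (conf_module_subtract_least hb ha).
by have [/ltW|[->]] := hm _ (candidate_subtract_least hb ha).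
Qed.

(** The set of selected moves is the same for both states, so [xget] picks the
    same element of it. *)
Lemma algo_select_scale lam s : 0 < sigma_r lam ->
  algo_select (scale_state lam s) = algo_select s.
Proof.
move=> hl; rewrite /Defs.algo_select; congr xget; apply/seteqP.
have ce d : candidate (scale_state lam s) d <-> candidate s d.
  by rewrite /Defs.candidate apply_move_scale; exact: positive_scale.
have me d : candidate s d -> conf_module (apply_move d (scale_state lam s))
    = conf_module (apply_move d s).
  by move=> hd; rewrite apply_move_scale conf_module_scale.
split=> d /= [hd hm].
  have hd' := (ce d).1 hd; split=> // d' hd2; have := hm d' ((ce d').2 hd2).
  by rewrite !me.
split=> [|d' /ce hd2]; first exact/ce.
by have := hm d' hd2; rewrite !me.
Qed.

Lemma algo_step_scale lam s : 0 < sigma_r lam ->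
  algo_step (scale_state lam s) = scale_state lam (algo_step s).
Proof.
move=> hl; rewrite /Defs.algo_step algo_select_scale // apply_move_scale.
exact: resort_scale.
Qed.

Lemma algo_orbitS s t : algo_orbit s t.+1 = algo_step (algo_orbit s t).
Proof. by []. Qed.

Lemma algo_orbitD s t t' : algo_orbit s (t + t') = algo_orbit (algo_orbit s t) t'.
Proof. by rewrite addnC /Defs.algo_orbit iterD. Qed.

Lemma algo_orbit_scale lam s t : 0 < sigma_r lam ->
  algo_orbit (scale_state lam s) t = scale_state lam (algo_orbit s t).
Proof. by move=> hl; elim: t => // t IH; rewrite !algo_orbitS IH algo_step_scale. Qed.

Lemma periodic_from_recurrence s lam t0 P : 0 < sigma_r lam ->
  algo_orbit s (t0 + P) = scale_state lam (algo_orbit s t0) ->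
  forall t, (t0 <= t)%N ->
    algo_orbit s (t + P) = scale_state lam (algo_orbit s t) /\
    algo_digit s (t + P) = algo_digit s t.
Proof.
move=> hl h t /subnKC <-; set k := (t - t0)%N.
have E : algo_orbit s (t0 + k + P) = scale_state lam (algo_orbit s (t0 + k)).
  by rewrite addnAC algo_orbitD h algo_orbit_scale // -algo_orbitD.
by split=> //; rewrite /Defs.algo_digit E algo_select_scale.
Qed.

(** * Orbits in an order have bounded module *)

Context (L : {pred K}) (L_order : is_order L).

Lemma order_zmod : zmod_closed L.
Proof. by have [h _ _] := L_order; exact: GRing.subring_closedB h. Qed.

Lemma order_sub : {in L &, forall u v, u - v \in L}.
Proof. by have [] := order_zmod. Qed.

Lemma order_add : {in L &, forall u v, u + v \in L}.
Proof. by have [] := GRing.zmod_closedD order_zmod. Qed.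

Lemma order_mul : {in L &, forall u v, u * v \in L}.
Proof. by have [[]] := L_order. Qed.

Lemma order_mulrn u n : u \in L -> u *+ n \in L.
Proof.
move=> hu; elim: n => [|n IH]; first by have [] := order_zmod.
by rewrite mulrS order_add.
Qed.

Lemma is_state_step s : is_state L s -> is_state L (algo_step s) /\
  `|\det (embmx (algo_step s))| = `|\det (embmx s)|.
Proof.
move=> [hL hb]; have hd : `|\det (embmx (algo_step s))| = `|\det (embmx s)|.
  by rewrite norm_det_resort det_apply_move.
split=> //; split; last first.
  apply: basis_embmx.
  by rewrite -normr_eq0 hd normr_eq0 det_embmx_neq0.
move=> i; rewrite /Defs.algo_step.
have [p ->] := resort_perm (apply_move (algo_select s) s).
move: (p i) => {}i; case: (algo_select s) => [A B g h|];
  case: (ord3P i) => ->; rewrite (tnth_nth 0) /=;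
  by rewrite ?order_sub ?order_mulrn ?order_sub ?order_mulrn.
Qed.

Lemma orbit_invariants s t : is_state L s -> admissible s ->
  [/\ is_state L (algo_orbit s t), admissible (algo_orbit s t)
    & `|\det (embmx (algo_orbit s t))| = `|\det (embmx s)|].
Proof.
move=> hs ha; elim: t => // t [IH1 IH2 IH3]; rewrite algo_orbitS.
have [h1 h2] := is_state_step IH1; split=> //; last by rewrite h2.
by apply: admissible_step => //; have [] := IH1.
Qed.

Lemma conf_module_orbit_growth s t : is_state L s -> admissible s ->
  conf_module (algo_orbit s t) <= 3 ^+ t * conf_module s.
Proof.
move=> hs ha; elim: t => [|t IH]; first by rewrite mul1r.
have [[_ hb] ha' _] := orbit_invariants t hs ha.
rewrite algo_orbitS (le_trans (conf_module_step hb ha')) //.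
by rewrite exprS -mulrA ler_pM2l.
Qed.

(** Each block of kappa steps divides the module by gamma until it drops to
    M. *)
Lemma conf_module_descent (kappa : nat) (gamma m0 M : R) : 1 < gamma -> m0 <= M ->
  (forall s, is_state L s -> admissible s -> m0 <= conf_module s ->
    exists2 t, (t <= kappa)%N &
      conf_module (algo_orbit s t) <= Num.max (conf_module s / gamma) m0) ->
  forall n s, is_state L s -> admissible s ->
    conf_module s <= gamma ^+ n * M ->
    exists2 t, (t <= n * kappa)%N & conf_module (algo_orbit s t) <= M.
Proof.
move=> g1 m0M hC; elim=> [|n IH] s hs ha hm.
  by exists 0%N => //; move: hm; rewrite mul1r.
case: (leP (conf_module s) M) => [|Mm]; first by exists 0%N.
have g0 : 0 < gamma by apply: lt_trans g1.
have M0 : 0 <= M.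
  have := le_trans (conf_module_ge0 s) hm.
  by rewrite pmulr_rge0 // exprn_gt0.
have [t1 t1k ht1] := hC s hs ha (le_trans m0M (ltW Mm)).
have [hs1 ha1 _] := orbit_invariants t1 hs ha.
have [|t2 t2k ht2] := IH _ hs1 ha1.
  apply: (le_trans ht1); rewrite ge_max; apply/andP; split.
    by rewrite ler_pdivrMr // mulrAC -exprSr.
  by rewrite (le_trans m0M) // ler_peMl // exprn_ege1 // ltW.
by exists (t1 + t2)%N; rewrite ?algo_orbitD // mulSn leq_add.
Qed.

(** The module is at most M at the start, and whenever it is at most M it is at
    most M again after between 1 and N steps: one step multiplies it by at
    most 3 <= gamma^n, and n kappa further steps undo this.  Between such
    times it grows by at most 3^N. *)
Lemma conf_module_orbit_bounded kappa s : hypC sigma_r sigma_c tie L kappa ->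
  is_state L s -> admissible s ->
  exists C, forall t, conf_module (algo_orbit s t) <= C.
Proof.
move=> [gamma [m0 [g1 m01 hC]]] hs ha.
pose M := Num.max (conf_module s) m0.
have m0M : m0 <= M by rewrite le_max lexx orbT.
have M0 : 0 <= M by apply: le_trans m0M; apply: le_trans m01.
have [n hn] := expr_unbounded 3%:R g1.
pose N := (n * kappa).+1.
exists (3 ^+ N * M) => T.
(* Every T is preceded by a time t0 > T - N with small module. *)
suff [t0 t0T [Tt0 ht0]] : exists2 t0, (t0 <= T)%N &
    (T < t0 + N)%N /\ conf_module (algo_orbit s t0) <= M.
  have [hs0 ha0 _] := orbit_invariants t0 hs ha.
  rewrite -(subnKC t0T) algo_orbitD.
  apply: (le_trans (conf_module_orbit_growth _ hs0 ha0)).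
  apply: ler_pM => //; rewrite ?exprn_ge0 ?conf_module_ge0 //.
  rewrite ler_weXn2l // ?ler1n //.
  by rewrite leq_subLR ltnW.
elim: T => [|T [t0 t0T [Tt0 ht0]]].
  by exists 0%N => //; rewrite le_max lexx.
case: (ltnP T.+1 (t0 + N)) => h.
  by exists t0 => //; exact: leqW.
have [hs0 ha0 _] := orbit_invariants t0 hs ha.
have [hs1 ha1 _] := orbit_invariants t0.+1 hs ha.
have [|t1 t1k ht1] := conf_module_descent g1 m0M hC (n := n) hs1 ha1.
  rewrite algo_orbitS; have [_ hb0] := hs0.
  apply: (le_trans (conf_module_step hb0 ha0)).
  by apply: ler_pM; rewrite ?conf_module_ge0.
exists (t0.+1 + t1)%N; last split.
- by apply: leq_trans h; rewrite addSnnS leq_add2l ltnS.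
- by apply: leq_ltn_trans Tt0 _; rewrite addSn addSn ltnS -addnA leq_add2l leq_addl.
- by rewrite algo_orbitD.
Qed.

(** * Arithmetic of the order *)

Definition is_Zbasis (e : 3.-tuple K) : Prop := basis_of {:K} e /\
  forall x, x \in L <-> exists c : 'I_3 -> int, x = \sum_i (c i)%:~R * tnth e i.

Lemma order_Zbasis : exists e, is_Zbasis e.
Proof.
have [_ _ [e he hL]] := L_order; move: e he hL.
by rewrite dimK => e he hL; exists e.
Qed.

Section IntegralBasis.
Context (e : 3.-tuple K) (e_Zbasis : is_Zbasis e).

(** The coordinates of an element of L are integers, and [numq] reads them off;
    see [coord_order]. *)
Definition icoord (u : K) (j : 'I_3) : int := numq (coord e j u).

Lemma coord_Zcomb (c : 'I_3 -> int) j :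
  coord e j (\sum_i (c i)%:~R * tnth e i) = (c j)%:~R.
Proof.
have [he _] := e_Zbasis.
rewrite -[RHS](coord_sum_free (fun i => (c i)%:~R) _ (basis_free he)).
congr coord; apply: eq_bigr => i _.
by rewrite scaler_int mulrzl (tnth_nth 0).
Qed.

Lemma Zcomb_order (c : 'I_3 -> int) : \sum_i (c i)%:~R * tnth e i \in L.
Proof. by have [_ hL] := e_Zbasis; apply/hL; exists c. Qed.

Lemma coord_order u j : u \in L -> coord e j u = (icoord u j)%:~R.
Proof.
have [_ hL] := e_Zbasis; move/hL => [c ->].
by rewrite /icoord coord_Zcomb numq_int.
Qed.

Lemma order_Zcomb u : u \in L -> u = \sum_i (icoord u i)%:~R * tnth e i.
Proof.
have [_ hL] := e_Zbasis; move/hL => [c ->].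
by apply: eq_bigr => i _; rewrite /icoord coord_Zcomb numq_int.
Qed.

Lemma basis_in_order i : tnth e i \in L.
Proof.
have [_ hL] := e_Zbasis; apply/hL; exists (fun j => (j == i)%:Z).
rewrite (bigD1 i) //= eqxx mul1r big1 ?addr0 // => j /negbTE ->; exact: mul0r.
Qed.

(** The matrix M of multiplication by u in an integral basis has integer
    entries, so its determinant is an integer n.  The adjugate of M is integral
    too, and adj M * M = n shows that n e_k is a multiple of u in L for every k;
    hence so is n * 1. *)
Lemma norm_multiple u : u \in L -> 0 < sigma_r u ->
  exists2 n : nat, (0 < n)%N & real_norm u = n%:R /\
    exists2 w, w \in L & n%:R = u * w.
Proof.
move=> uL u0; have [he hL] := e_Zbasis.
pose M : 'M[int]_3 := \matrix_(i, j) icoord (u * tnth e i) j.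
have ueL i : u * tnth e i \in L by apply: order_mul => //; exact: basis_in_order.
have EM : coordmx e (scale_state u e) = map_mx intr M.
  by apply/matrixP => i j; rewrite !mxE tnth_map coord_order.
have EN : real_norm u = (\det M)%:~R.
  by rewrite (real_norm_coord u he) EM det_map_mx ratr_int.
have N0 := real_norm_gt0 u0.
have d0 : 0 < \det M by move: N0; rewrite EN ltr0z.
have [n En] : exists n : nat, \det M = n.
  by exists `|\det M|%N; rewrite gez0_abs // ltW.
exists n; first by move: d0; rewrite En.
split; first by rewrite EN En.
pose a := icoord 1.
exists (\sum_i (\sum_k a k * (\adj M) k i)%:~R * tnth e i); first exact: Zcomb_order.
have key k : n%:R * tnth e k = u * \sum_i ((\adj M) k i)%:~R * tnth e i.
  have := mul_adj_mx M => /matrixP adjM.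
  transitivity (\sum_j ((\adj M *m M) k j)%:~R * tnth e j).
    rewrite (bigD1 k) //= big1 ?addr0; last first.
      by move=> j jk; rewrite adjM mxE eq_sym (negbTE jk) mul0r.
    by rewrite adjM mxE eqxx En.
  rewrite mulr_sumr.
  transitivity (\sum_i ((\adj M) k i)%:~R * (u * tnth e i)); last first.
    by apply: eq_bigr => i _; rewrite mulrCA.
  under [RHS]eq_bigr => i _ do rewrite (order_Zcomb (ueL i)) mulr_sumr.
  rewrite exchange_big /=; apply: eq_bigr => j _.
  rewrite mxE rmorph_sum mulr_suml; apply: eq_bigr => i _.
  by rewrite rmorphM /= mulrA [M _ _]mxE.
have h1 : 1 \in L by have [[]] := L_order.
transitivity (n%:R * \sum_k (a k)%:~R * tnth e k).
  by rewrite -(order_Zcomb h1) mulr1.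
rewrite mulr_sumr.
under eq_bigr => k _ do rewrite mulrCA key mulrCA mulr_sumr.
rewrite -mulr_sumr exchange_big /=; congr (u * _); apply: eq_bigr => i _.
rewrite rmorph_sum mulr_suml; apply: eq_bigr => k _.
by rewrite rmorphM /= mulrA.
Qed.

(** Let n be the norm of v, so that n = v w with w in L and n divides N!.  Then
    u = v + N! z = v (1 + w z N! / n).  Working modulo N! rather than n makes
    the congruence the same for all norms up to N. *)
Lemma quotient_in_order u v (N : nat) : u \in L -> v \in L -> 0 < sigma_r v ->
  real_norm v <= N%:R ->
  (forall j, icoord u j = icoord v j %[mod N`!])%Z -> u / v \in L.
Proof.
move=> uL vL v0 vN hmod; have [n n0 [En [w wL Ew]]] := norm_multiple vL v0.
have /dvdnP[q Eq] : (n %| N`!)%N by rewrite dvdn_fact // n0 -(ler_nat R) -En.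
pose c j := ((icoord u j - icoord v j) %/ N`!)%Z.
pose z := \sum_i (c i)%:~R * tnth e i.
have zL : z \in L by exact: Zcomb_order.
have Ez : u = v + N`!%:R * z.
  rewrite {1}(order_Zcomb uL) {1}(order_Zcomb vL) mulr_sumr -big_split /=.
  apply: eq_bigr => j _; rewrite mulrA -mulrDl; congr (_ * _).
  rewrite -[N`!%:R]/((N`!)%:Z%:~R) -rmorphM -rmorphD /=; congr (_%:~R).
  have : (N`! %| icoord u j - icoord v j)%Z by rewrite -eqz_mod_dvd; apply/eqP/hmod.
  by move=> /divzK; rewrite mulrC -/(c j) => ->; rewrite addrC subrK.
have v1 : v != 0 by apply: contraTneq v0 => ->; rewrite rmorph0 ltxx.
have -> : u / v = 1 + (w * z) *+ q.
  by rewrite Ez Eq natrM Ew -[_ *+ q]mulr_natl; field.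
have h1 : 1 \in L by have [[]] := L_order.
apply: order_add => //; apply: order_mulrn => //; exact: order_mul.
Qed.

(** Discreteness of L: integer coordinates are obtained from the embeddings by
    the fixed matrix inverse to that of e. *)
Lemma icoord_bound (B : R) : exists N : nat, forall s : 3.-tuple K,
  (forall i, tnth s i \in L) -> (forall i j, `|place j (tnth s i)| <= B) ->
  forall i j, (`|icoord (tnth s i) j| <= N%:Z)%R.
Proof.
have [he _] := e_Zbasis.
pose S := \sum_k \sum_j `|invmx (embmx e) k j|.
exists (Num.bound (`|B| * S)) => s sL sB i j.
have ue : embmx e \in unitmx by rewrite unitmxE unitfE det_embmx_neq0.
have E : map_mx ratr (coordmx e s) = embmx s *m invmx (embmx e).
  by rewrite (embmx_coord s he) mulmxK.
have := congr1 (fun M : 'M[R]_3 => M i j) E.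
rewrite !mxE coord_order // ratr_int => Eij.
rewrite -(ler_int R) intr_norm Eij.
have S0 : 0 <= `|B| * S by rewrite mulr_ge0 // !sumr_ge0 // => k _; rewrite sumr_ge0.
apply/ltW/(le_lt_trans _ (archi_boundP S0)).
apply: (le_trans (ler_norm_sum _ _ _)); rewrite mulr_sumr; apply: ler_sum => k _.
rewrite normrM; apply: ler_pM => //.
  by rewrite mxE (le_trans (sB _ _)) // ler_norm.
by rewrite (bigD1 j) //= lerDl sumr_ge0.
Qed.

End IntegralBasis.

(** * Recurrence up to units *)

Lemma real_norm_le_height s : real_norm (tnth s 0) <= ratr (state_height s).
Proof.
rewrite real_norm_field_norm ler_rat.
apply: le_trans (ler_norm _) _.
exact: (le_bigmax 0 (fun i => `|field_norm (tnth s i)|)).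
Qed.

(** C bounds both squared distances to the line of xi, by [conf_moduleE] and
    sigma_r u_1 <= |xi|; [entry_bound] then bounds the other entries by the
    first one. *)
Lemma place_bound s (C : R) : admissible s -> \det (embmx s) != 0 ->
  2 * `|\det (embmx s)| * conf_module s <= C * sigma_r (tnth s 0) ->
  forall i j, `|place j (tnth s i)| <= \sum_k `|place k (tnth s 0)| + 2 * (C + 1).
Proof.
move=> [hp hs] d0 hC i j.
have x0 := hp 0; have v0 := positive_dot hp.
set xi := placev s 0 in v0.
have xix : sigma_r (tnth s 0) <= enorm xi.
  have n0 := enorm_ge0 xi.
  rewrite -(@ler_pXn2r _ 2) ?nnegrE ?(ltW x0) // sqr_enorm dotE !mxE /place /= expr2.
  by rewrite -addrA lerDl addr_ge0 // -expr2 sqr_ge0.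
have g0 k : 0 <= sqdist_line xi (placev s k) by rewrite sqdist_line_ge0 // lt0r_neq0.
have gC k : k = 1 \/ k = 2%:R -> sqdist_line xi (placev s k) <= C.
  have D0 : 0 < `|\det (embmx s)| by rewrite normr_gt0.
  have : (sqdist_line xi (placev s 1) + sqdist_line xi (placev s 2%:R))
      * enorm xi <= C * sigma_r (tnth s 0).
    apply: le_trans hC; rewrite conf_moduleE // -/xi.
    rewrite le_eqVlt; apply/orP; left; apply/eqP; field.
    by rewrite gt_eqF.
  move=> h kk; rewrite -(ler_pM2r x0); apply: le_trans h.
  apply: ler_pM => //; first exact: ltW.
  by case: kk => ->; rewrite ?lerDl ?lerDr.
have sum_ge k : `|place k (tnth s 0)| <= \sum_k `|place k (tnth s 0)|.
  by rewrite (bigD1 k) //= lerDl sumr_ge0.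
have C0 : 0 <= C by apply: le_trans (gC 1 _); [exact: g0 | left].
have hxi k : 0 < xi 0 k <= xi 0 0.
  by rewrite !mxE; apply/andP; split; [exact: hp | exact: sorted_le_first].
have hb k : k = 1 \/ k = 2%:R ->
    `|place k (tnth s i)| <= \sum_k `|place k (tnth s 0)| + 2 * (C + 1).
  move=> hk; have := entry_bound hxi (gC k hk) i; rewrite !mxE.
  by move/le_trans; apply; rewrite lerD2r.
case: (ord3P j) => ->; [|apply: hb; by left|apply: hb; by right].
apply: (@le_trans _ _ (`|place 0 (tnth s 0)|)).
  by have := sorted_le_first hs i; rewrite /place /= !gtr0_norm //; exact: hp.
by apply: le_trans (sum_ge 0) _; rewrite lerDl mulr_ge0 // addr_ge0.
Qed.

(** Two applications of the pigeonhole principle: the first selects times at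
    which the first entries differ by units, the second finds two equal states
    among those rescaled to have a common first entry. *)
Lemma recurrence_up_to_unit (o : nat -> 3.-tuple K) (D C M0 : R) :
  (forall t, is_state L (o t)) -> (forall t, admissible (o t)) ->
  (forall t, `|\det (embmx (o t))| = D) -> (forall t, conf_module (o t) <= C) ->
  (forall N, exists2 t, (N <= t)%N & ratr (state_height (o t)) <= M0) ->
  exists t1 t2 lam, [/\ (t1 < t2)%N, is_unit_OK lam, 0 < sigma_r lam &
    o t2 = scale_state lam (o t1)].
Proof.
move=> oL oa oD oC oH; have [e he] := order_Zbasis.
have [M hM] : exists M : nat, forall N,
    exists2 t, (N <= t)%N & real_norm (tnth (o t) 0) <= M%:R.
  exists (Num.bound `|M0|) => N; have [t Nt ht] := oH N; exists t => //.
  apply: le_trans (real_norm_le_height _) _; apply: (le_trans ht).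
  by apply: le_trans (ler_norm _) (ltW (archi_boundP _)).
pose u t := tnth (o t) 0.
have uL t : u t \in L by have [h _] := oL t; exact: h.
have up t : 0 < sigma_r (u t) by have [h _] := oa t; exact: h.
have u0 t : u t != 0 by apply: contraTneq (up t) => ->; rewrite rmorph0 ltxx.
pose f t := [ffun j => inord `|(icoord e (u t) j %% M`!)%Z|%N : 'I_(M`!).+1].
have [c hc] := pigeonhole_infinite f hM.
have quotL t t' : real_norm (u t) <= M%:R /\ f t = c ->
    real_norm (u t') <= M%:R /\ f t' = c -> u t / u t' \in L.
  move=> [_ ft] [Mt' ft']; apply: (quotient_in_order he _ _ _ Mt') => // j.
  have := congr1 (fun F : {ffun 'I_3 -> 'I_(M`!).+1} => nat_of_ord (F j))
    (etrans ft (esym ft')).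
  have fact0 : M`!%:Z != 0 by rewrite eqz_nat -lt0n fact_gt0.
  have lt_mod z : (`|(z %% M`!)%Z|%N < (M`!).+1)%N.
    rewrite ltnS ltnW // -ltz_nat gez0_abs ?modz_ge0 //.
    by rewrite ltz_pmod // ltz_nat fact_gt0.
  rewrite !ffunE !inordK //= => E.
  by rewrite -(gez0_abs (modz_ge0 (icoord e (u t) j) fact0)) E gez0_abs ?modz_ge0.
have [r _ hr] := hc 0%N.
have lampos t : 0 < sigma_r (u r / u t) by rewrite rmorphM fmorphV divr_gt0.
(* The states rescaled to have the first entry u r.  The determinant of st t is
   D N(u r) / N(u t), which is at most D M because N(u t) is a positive
   integer. *)
pose st t := scale_state (u r / u t) (o t).
have st0 t : tnth (st t) 0 = u r by rewrite tnth_map divfK.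
have D0 : 0 < D.
  by rewrite -(oD 0%N) normr_gt0 det_embmx_neq0 //; have [] := oL 0%N.
pose C' := 2 * (D * M%:R) * C / sigma_r (u r).
pose B := \sum_k `|place k (u r)| + 2 * (C' + 1).
have st_bound t : real_norm (u t) <= M%:R /\ f t = c ->
    forall i j, `|place j (tnth (st t) i)| <= B.
  move=> ht i j; rewrite /B -(st0 t); apply: place_bound.
  - split; first by apply/(positive_scale _ (lampos t)); have [] := oa t.
    exact: sorted_scale (lampos t) (proj2 (oa t)).
  - rewrite det_embmx_scale; apply: mulf_neq0; last by rewrite gt_eqF ?real_norm_gt0.
    by rewrite det_embmx_neq0 //; have [] := oL t.
  - rewrite st0 divfK ?gt_eqF // det_embmx_scale normrM oD.
    rewrite conf_module_scale //; last by have [] := oa t.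
    apply: ler_pM => //; [|exact: conf_module_ge0|].
      by rewrite mulr_ge0 // mulr_ge0 // ltW.
    rewrite ler_pM2l // ler_pM2l // gtr0_norm ?real_norm_gt0 //.
    have [n n0 [En _]] := norm_multiple he (uL t) (up t).
    have : real_norm (u r / u t * u t) <= M%:R by rewrite divfK // hr.1.
    rewrite (real_normM (u r / u t)) En.
    apply: le_trans; rewrite ler_peMr ?ler1n //; exact: ltW (real_norm_gt0 _).
have [N hN] := icoord_bound he B.
pose g t := [ffun p : 'I_3 * 'I_3 =>
  inord `|(icoord e (tnth (st t) p.1) p.2 + N%:Z)%R|%N : 'I_(2 * N).+1].
have [c' hc'] := pigeonhole_infinite g hc.
have [t1 _ [ht1 gt1]] := hc' 0%N.
have [t2 t12 [ht2 gt2]] := hc' t1.+1.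
have stL t : real_norm (u t) <= M%:R /\ f t = c ->
    forall i, tnth (st t) i \in L.
  move=> ht i; rewrite tnth_map; apply: order_mul; first exact: quotL.
  by have [h _] := oL t; exact: h.
have Est : st t1 = st t2.
  apply: eq_from_tnth => i.
  rewrite (order_Zcomb he (stL _ ht1 i)) (order_Zcomb he (stL _ ht2 i)).
  apply: eq_bigr => j _; congr (_%:~R * _).
  have := congr1
    (fun F : {ffun 'I_3 * 'I_3 -> 'I_(2 * N).+1} => nat_of_ord (F (i, j)))
    (etrans gt1 (esym gt2)).
  have := hN _ (stL _ ht1) (st_bound _ ht1) i j.
  have := hN _ (stL _ ht2) (st_bound _ ht2) i j.
  rewrite !ffunE /=; move: (icoord _ _ _) (icoord _ _ _) => a b.
  by move=> ha hb; rewrite !inordK; lia.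
exists t1, t2, (u t2 / u t1); split=> //.
- have [_ intL _] := L_order; split; first by rewrite mulf_neq0 ?invr_eq0 ?u0.
    by apply/intL/quotL.
  by rewrite invf_div; apply/intL/quotL.
- by rewrite rmorphM fmorphV divr_gt0.
- have := congr1 (scale_state (u t2 / u r)) Est; rewrite !scale_stateA.
  have -> : u t2 / u r * (u r / u t1) = u t2 / u t1 by field; rewrite !u0.
  have -> : u t2 / u r * (u r / u t2) = 1 by field; rewrite !u0.
  move=> ->; apply: eq_from_tnth => i; by rewrite tnth_map mul1r.
Qed.

End Orbits.

Theorem theorem4p6 (R : realType) (K : fieldExtType rat)
    (sigma_r : {rmorphism K -> R}) (sigma_c : {rmorphism K -> R[i]})
    (L : {pred K}) (tie : rel move) (kappa : nat) (s0 : 3.-tuple K) :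
  \dim {:K} = 3%N ->
  has_signature11 sigma_r sigma_c ->
  is_order L ->
  is_total_order tie ->
  hypC sigma_r sigma_c tie L kappa ->
  is_state L s0 -> admissible sigma_r s0 ->
  hypB sigma_r sigma_c tie s0 ->
  exists (t0 P : nat) (lambda : K),
    [/\ (1 <= P)%N, is_unit_OK lambda, 0 < sigma_r lambda,
        forall t, (t0 <= t)%N ->
          algo_orbit sigma_r sigma_c tie s0 (t + P) =
          scale_state lambda (algo_orbit sigma_r sigma_c tie s0 t)
      & exists t1 : nat, forall t, (t1 <= t)%N ->
          algo_digit sigma_r sigma_c tie s0 (t + P) =
          algo_digit sigma_r sigma_c tie s0 t].
Proof.
move=> dimK [_ hx _] L_order tieP hC hs ha /infinitely_often_le[M hM].
have [C hm] := conf_module_orbit_bounded dimK hx tieP L_order hC hs ha.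
have inv t := orbit_invariants dimK hx tieP L_order t hs ha.
have [t1 [t2 [lam [t12 lamU lam0 E]]]] := recurrence_up_to_unit dimK hx L_order
  (fun t => let: And3 h _ _ := inv t in h) (fun t => let: And3 _ h _ := inv t in h)
  (fun t => let: And3 _ _ h := inv t in h) hm hM.
have per := periodic_from_recurrence (t0 := t1) (P := (t2 - t1)%N) lam0.
rewrite subnKC 1?ltnW // in per.
exists t1, (t2 - t1)%N, lam; split=> //; first by rewrite subn_gt0.
  by move=> t /(per _ _ _ E)[].
by exists t1 => t /(per _ _ _ E)[].
Qed.
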